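(* Let $n\ge2$, let $(a,b)$ be an open interval, and let $\Lambda=(\lambda_i)_{i=1}^n\in(a,b)^n$ be a sequence of distinct points. For every $f\in C^{2n-1}(a,b)$, $$L(\Lambda,f)=(2n-1)\int_{-\infty}^{\infty}C^{T}(t,\Lambda)\,M_n(t,f)\,C(t,\Lambda)\,I_\Lambda(t)\,dt .$$
   Context: Functions $f$ are real-valued. $[\lambda,\mu]_f=\frac{f(\lambda)-f(\mu)}{\lambda-\mu}$ for $\lambda\ne\mu$ and $[\lambda,\lambda]_f=f'(\lambda)$ (first divided difference). The Loewner matrix is $L(\Lambda,f)=([\lambda_i,\lambda_j]_f)_{1\le i,j\le n}$. The Hankel matrix is $M_n(t,f)=\left(\frac{f^{(i+j-1)}(t)}{(i+j-1)!}\right)_{1\le i,j\le n}$. The $n\times n$ matrix $C(t,\Lambda)$ is defined by letting $C_{i,j}(t,\Lambda)$ be the coefficient of $y^{i-1}$ in the polynomial $g_{j}(t,y)=\prod_{k\ne j}(1+y(t-\lambda_k))$ in the variable $y$ (product over $1\le k\le n$, $k\neq j$); $C^T$ denotes its transpose. Put $p_\Lambda(z)=\prod_{i=1}^n(z-\lambda_i)$ and, for $1\le i\le n$ and $t\in\mathbb{R}$, $I_i(t)=\operatorname{Res}_{z=\lambda_i}\left(-\frac{(z-t)^{2n-2}}{p_\Lambda(z)^2}\right)$. The weight is $I_\Lambda(t)=\sum_{1\le i\le n,\ \lambda_i<t}I_i(t)$. It is a continuous piecewise polynomial function supported on $[\min(\Lambda),\max(\Lambda)]\subset(a,b)$; the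 integrand is understood to be zero outside this interval. The integral of a matrix-valued function is taken entrywise. *)

(* Defs.v *)
From HB Require Import structures.
From mathcomp Require Import all_boot all_order all_algebra.
From mathcomp Require Import all_classical all_reals all_analysis.
From mathcomp Require Import ring.

Set Implicit Arguments.
Unset Strict Implicit.
Unset Printing Implicit Defensive.

Import Order.TTheory GRing.Theory Num.Theory.
Import numFieldNormedType.Exports.

Local Open Scope classical_set_scope.
Local Open Scope ring_scope.

Definition regular_at (K : fieldType) (F : {fraction {poly K}}) (c : K) : Prop :=
  exists p q : {poly K}, ~~ root q c /\ F = tofrac p / tofrac q.

(** [a k] is the coefficient of [(z - c)^-(k+1)] in the Laurent expansion of
    [F] at [c]; leading coefficients may vanish, so that [m.+1] is only an upper
    bound on the order of the pole. *)
Definition is_residue (K : fieldType) (F : {fraction {poly K}}) (c r : K) : Prop :=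
  exists (m : nat) (a : nat -> K), a 0%N = r /\
    regular_at
      (F - \sum_(k < m.+1) tofrac (a k)%:P / tofrac (('X - c%:P) ^+ k.+1)) c.

Lemma principal_part_eq0 (K A : fieldType) (phi : {rmorphism {poly K} -> A})
    (c : K) (M : nat) (b : nat -> K) (p q : {poly K}) :
  injective phi -> ~~ root q c ->
  \sum_(k < M.+1) phi (b k)%:P / phi (('X - c%:P) ^+ k.+1) = phi p / phi q ->
  b 0%N = 0.
Proof.
move=> phiI qc E; pose L := 'X - c%:P : {poly K}.
have phi_eq0 x : x != 0 -> phi x != 0 by rewrite -(rmorph0 phi) (inj_eq phiI).
have Lk k : phi (L ^+ k) != 0 by rewrite phi_eq0 // expf_neq0 // polyXsubC_eq0.
have q0 : phi q != 0.
  by apply: phi_eq0; apply: contraNneq qc => ->; rewrite root0.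
pose B := \sum_(k < M.+1) (b k)%:P * L ^+ (M - k).
have EB : B * q = p * L ^+ M.+1.
  apply: phiI; rewrite !rmorphM.
  suff -> : phi B = phi p / phi q * phi (L ^+ M.+1) by rewrite mulrAC mulfVK.
  rewrite -E mulr_suml raddf_sum; apply: eq_bigr => k _ /=.
  have -> : L ^+ M.+1 = L ^+ k.+1 * L ^+ (M - k).
    by rewrite -exprD addSn subnKC // -ltnS.
  by rewrite !rmorphM mulrA mulfVK.
have B0 : B = 0.
  apply/eqP; apply/negPn/negP => nB0.
  have : L ^+ M.+1 %| B * q by rewrite EB dvdp_mull.
  rewrite Gauss_dvdpl; last first.
    by rewrite coprimep_expl // coprimep_sym coprimep_XsubC.
  move/(dvdp_leq nB0); apply/negP; rewrite -ltnNge size_exp_XsubC ltnS.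
  apply: (leq_trans (size_sum _ _ _)); apply/bigmax_leqP => k _.
  by rewrite mul_polyC (leq_trans (size_scale_leq _ _)) // size_exp_XsubC ltnS leq_subr.
have : B`_M = 0 by rewrite B0 coef0.
rewrite coef_sum big_ord_recl /= subn0 mul_polyC coefZ.
have -> : (L ^+ M)`_M = 1.
  by have /monicP := monic_exp M (monicXsubC c); rewrite lead_coefE size_exp_XsubC.
rewrite mulr1 big1 ?addr0 // => k _.
rewrite mul_polyC coefZ nth_default ?mulr0 // size_exp_XsubC.
by rewrite /bump /= add1n; case: M k {E B EB B0} => [[]//|M] k; rewrite subSS ltnS leq_subr.
Qed.

Lemma principal_part_unique (K A : fieldType) (phi : {rmorphism {poly K} -> A})
    (F : A) (c : K) (m m' : nat) (a a' : nat -> K) (p q p' q' : {poly K}) :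
  injective phi -> ~~ root q c -> ~~ root q' c ->
  F - \sum_(k < m.+1) phi (a k)%:P / phi (('X - c%:P) ^+ k.+1) = phi p / phi q ->
  F - \sum_(k < m'.+1) phi (a' k)%:P / phi (('X - c%:P) ^+ k.+1)
    = phi p' / phi q' ->
  a 0%N = a' 0%N.
Proof.
move=> phiI qc qc' Epq Epq'.
pose ext (n : nat) (u : nat -> K) k := if (k < n.+1)%N then u k else 0.
pose M := maxn m m'.
pose S n (u : nat -> K) : A :=
  \sum_(k < n.+1) phi (u k)%:P / phi (('X - c%:P) ^+ k.+1).
have extE n u : (n <= M)%N -> S n u = S M (ext n u).
  move=> nM; rewrite /S (big_ord_widen M.+1
    (fun k => phi (u k)%:P / phi (('X - c%:P) ^+ k.+1))) ?ltnS //.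
  rewrite big_mkcond; apply: eq_bigr => k _; rewrite /ext.
  by case: ifP => // _; rewrite polyC0 rmorph0 mul0r.
suff : ext m a 0%N - ext m' a' 0%N = 0 by move/eqP; rewrite subr_eq0 => /eqP.
have nz x : ~~ root x c -> phi x != 0.
  move=> xc; rewrite -(rmorph0 phi) (inj_eq phiI).
  by apply: contraNneq xc => ->; rewrite root0.
apply: (@principal_part_eq0 _ _ phi c M (fun k => ext m a k - ext m' a' k)
  (p' * q - p * q') (q * q') phiI); first by rewrite rootM negb_or qc.
transitivity (S m a - S m' a').
  rewrite (extE m) ?leq_maxl // (extE m') ?leq_maxr // -sumrB; apply: eq_bigr => k _.
  by rewrite polyCB rmorphB mulrBl.
have -> : S m a - S m' a' = (F - S m' a') - (F - S m a).
  by rewrite opprB [RHS]addrC addrA subrK.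
rewrite [F - S m' a']Epq' [F - S m a]Epq rmorphB !rmorphM.
by field; rewrite !nz.
Qed.

Lemma is_residue_unique (K : fieldType) (F : {fraction {poly K}}) (c r s : K) :
  is_residue F c r -> is_residue F c s -> r = s.
Proof.
move=> [m [a [<- [p [q [qc E]]]]]] [m' [a' [<- [p' [q' [qc' E']]]]]].
apply: (principal_part_unique _ qc qc' E E').
by move=> x y /eqP; rewrite tofrac_eq => /eqP.
Qed.

(** For a rational function with real coefficients and a real point [c] this is
    the usual complex residue: the Laurent coefficients at [c] are real and do
    not depend on whether the expansion is taken over the reals or the complex
    numbers. *)
Definition residue (K : fieldType) (F : {fraction {poly K}}) (c : K) : K :=
  xget 0 [set r | is_residue F c r].

Lemma residueE (K : fieldType) (F : {fraction {poly K}}) (c r : K) :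
  is_residue F c r -> residue F c = r.
Proof.
move=> Fr; apply: (is_residue_unique _ Fr).
by apply: (@xgetPex _ 0 [set r | is_residue F c r]); exists r.
Qed.

(** The endpoints may be infinite. *)
Definition open_interval (R : realType) (a b : \bar R) : set R :=
  [set x | (a < x%:E < b)%E].

Definition class_C (R : realType) (m : nat) (D : set R) (f : R -> R) : Prop :=
  (forall k x, (k < m)%N -> D x -> derivable (f^`(k))%classic x 1) /\
  (forall x, D x -> {for x, continuous (f^`(m))%classic}).

Definition divided_difference (R : realType) (f : R -> R) (x y : R) : R :=
  if x == y then (f^`())%classic x else (f x - f y) / (x - y).

Definition loewner (R : realType) (n : nat) (lam : 'I_n -> R) (f : R -> R) :
    'M[R]_n :=
  \matrix_(i, j) divided_difference f (lam i) (lam j).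

(** Rows and columns are numbered from [0], so the usual [i + j - 1] becomes
    [(i + j).+1]. *)
Definition hankel (R : realType) (n : nat) (t : R) (f : R -> R) : 'M[R]_n :=
  \matrix_(i, j) ((f^`((i + j).+1))%classic t / ((i + j).+1)`!%:R).

Definition Cpoly (R : realType) (n : nat) (t : R) (lam : 'I_n -> R) (j : 'I_n) :
    {poly R} :=
  \prod_(k < n | k != j) (1 + (t - lam k) *: 'X).

Definition Cmx (R : realType) (n : nat) (t : R) (lam : 'I_n -> R) : 'M[R]_n :=
  \matrix_(i, j) (Cpoly t lam j)`_i.

Definition pLambda (R : realType) (n : nat) (lam : 'I_n -> R) : {poly R} :=
  \prod_(i < n) ('X - (lam i)%:P).

Definition Ires (R : realType) (n : nat) (lam : 'I_n -> R) (i : 'I_n) (t : R) : R :=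
  residue (- (tofrac (('X - t%:P) ^+ (2 * n - 2)) / tofrac (pLambda lam ^+ 2)))
    (lam i).

Definition weight (R : realType) (n : nat) (lam : 'I_n -> R) (t : R) : R :=
  \sum_(i < n | lam i < t) Ires lam i t.

Definition integrable_mx (R : realType) (m n : nat) (F : R -> 'M[R]_(m, n)) : Prop :=
  forall i j,
    (@lebesgue_measure R).-integrable setT (fun t => (F t i j)%:E).

Definition integral_mx (R : realType) (m n : nat) (F : R -> 'M[R]_(m, n)) :
    'M[R]_(m, n) :=
  \matrix_(i, j) \int[@lebesgue_measure R]_(t in setT) F t i j.

(** The derivatives of [f] take unspecified values outside the interval on which
    [f] is smooth; there they are multiplied by [weight lam t = 0]. *)
Definition integrand (R : realType) (n : nat) (lam : 'I_n -> R) (f : R -> R)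
    (t : R) : 'M[R]_n :=
  weight lam t *: ((Cmx t lam)^T *m hankel n t f *m Cmx t lam).

(* Main.v *)
Require Import Defs.
From HB Require Import structures.
From mathcomp Require Import all_boot all_order all_algebra.
From mathcomp Require Import all_classical all_reals all_analysis.
From mathcomp Require Import ring zify.

Import Order.TTheory GRing.Theory Num.Theory.
Import numFieldNormedType.Exports.

Set Implicit Arguments.
Unset Strict Implicit.

Local Open Scope classical_set_scope.
Local Open Scope ring_scope.

(** Put [N = 2n - 1] and [P = p^2 / ((z - lam i) (z - lam j))]. The substitution
    [y = 1 / (z - t)] turns [g_i g_j] into [P / (z - t)^(N - 1)], so the
    coefficients of [g_i g_j] are Taylor coefficients of [P] at [t], and by the
    Leibniz rule the [(i, j)] entry of [C^T M C] is [(f P)^(N) / N!].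

    Let [rho_r phi] be the residue of [- phi / p^2] at [lam r]. If [G_t] is the
    Taylor polynomial of [f P] at [t] of degree [N - 1], then the sum defining
    [d/dt rho_r G_t] telescopes to [N (f P)^(N)(t) / N! * I_r(t)]. Integrating
    over [(lam r, max lam]] and summing over [r], the contributions of the upper
    end point cancel, because the residues of [- phi / p^2] add up to zero when
    [deg phi <= N - 1]. At [t = lam r] only the terms of order 0 and 1 of [G_t]
    have a residue; they add up to the divided difference of [f]. *)

(** * Residues at a double pole *)

Lemma dvdp_XsubC_sqr (K : fieldType) (phi : {poly K}) (c : K) :
  phi.[c] = 0 -> phi^`().[c] = 0 -> ('X - c%:P) ^+ 2 %| phi.
Proof.
move=> /eqP phic; have [s ->] := factor_theorem phi c phic.
rewrite derivM derivXsubC hornerD !hornerM hornerXsubC subrr mulr0 add0r hornerC mulr1 => /eqP sc.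
by have [s' ->] := factor_theorem s c sc; rewrite -mulrA -expr2 dvdp_mull.
Qed.

(** The residue at [c] of [- phi / (('X - c) q)^2]. *)
Definition double_pole_residue (K : fieldType) (q : {poly K}) (c : K) (phi : {poly K}) : K :=
  2 * q^`().[c] / q.[c] ^+ 3 * phi.[c] - q.[c] ^- 2 * phi^`().[c].

(** The principal part of the same fraction at [c], multiplied by [('X - c)^2]. *)
Definition double_pole_part (K : fieldType) (q : {poly K}) (c : K) (phi : {poly K}) :
    {poly K} :=
  (double_pole_residue q c phi)%:P * ('X - c%:P) - (phi.[c] / q.[c] ^+ 2)%:P.

(** Subtracting the principal part [part / ('X - c)^2] from [- phi / (('X - c) q)^2] leaves the
    numerator [- (phi + part * q^2)]. Regularity at [c] is thus a double zero of this numerator,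
    checked on its value and first derivative. *)
Lemma double_pole_partP (K : fieldType) (q : {poly K}) (c : K) (phi : {poly K}) :
  ~~ root q c -> ('X - c%:P) ^+ 2 %| phi + double_pole_part q c phi * q ^+ 2.
Proof.
move=> qc; have qc0 : q.[c] != 0 by [].
apply: dvdp_XsubC_sqr; rewrite /double_pole_part /double_pole_residue.
  by rewrite !(hornerD, hornerN, hornerM, hornerC, hornerX, horner_exp); field.
rewrite expr2 !(derivD, derivM, derivN, derivC, derivX).
rewrite !(hornerD, hornerN, hornerM, hornerC, hornerX, horner_exp).
by field.
Qed.

Lemma double_pole_sub_part (K A : fieldType) (mor : {rmorphism {poly K} -> A})
    (q phi s : {poly K}) (c r e : K) :
  injective mor -> ~~ root q c ->
  phi + (r%:P * ('X - c%:P) - e%:P) * q ^+ 2 = s * ('X - c%:P) ^+ 2 ->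
  - (mor phi / mor ((('X - c%:P) * q) ^+ 2)) -
    \sum_(k < 2) mor (if k == 0%N :> nat then r else - e)%:P / mor (('X - c%:P) ^+ k.+1)
  = mor (- s) / mor (q ^+ 2).
Proof.
move=> morI qc Es.
have -> : phi = s * ('X - c%:P) ^+ 2 - (r%:P * ('X - c%:P) - e%:P) * q ^+ 2.
  by rewrite -Es addrK.
have nz x : x != 0 -> mor x != 0 by rewrite -(rmorph0 mor) (inj_eq morI).
have q0 : mor q != 0 by apply: nz; apply: contraNneq qc => ->; rewrite root0.
have L0 : mor ('X - c%:P) != 0 by rewrite nz // polyXsubC_eq0.
rewrite !big_ord_recl big_ord0 /= addr0 polyCN.
move: ('X - c%:P) L0 => L L0.
rewrite !(rmorphB, rmorphM, rmorphN, rmorphXn) /=.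
by field; rewrite q0.
Qed.

Lemma is_residue_double_pole (K : fieldType) (q : {poly K}) (c : K) (phi : {poly K}) :
  ~~ root q c ->
  is_residue (- (tofrac phi / tofrac ((('X - c%:P) * q) ^+ 2))) c
    (double_pole_residue q c phi).
Proof.
move=> qc; have [s Es] := dvdpP _ _ (double_pole_partP phi qc).
(* The pole has order at most 2: index 0 carries the residue, index 1 the coefficient of
   [('X - c)^-2]. *)
exists 1%N, (fun k => if k == 0%N then double_pole_residue q c phi
  else - (phi.[c] / q.[c] ^+ 2)); split => //.
exists (- s), (q ^+ 2); rewrite expr2 rootM negb_or qc; split=> //.
apply: (double_pole_sub_part _ qc Es).
by move=> x y /eqP; rewrite tofrac_eq => /eqP.
Qed.

(** * Cofactors of the nodal polynomial and the vanishing sum of residues *)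

Definition other_factors (K : fieldType) (n : nat) (lam : 'I_n -> K) (r : 'I_n) : {poly K} :=
  \prod_(k < n | k != r) ('X - (lam k)%:P).

Lemma other_factors_root (K : fieldType) (n : nat) (lam : 'I_n -> K) (r : 'I_n) :
  injective lam -> ~~ root (other_factors lam r) (lam r).
Proof.
move=> hinj; rewrite /root horner_prod; apply/prodf_neq0 => k kr.
by rewrite hornerXsubC subr_eq0 inj_eq // eq_sym.
Qed.

Lemma other_factors_root_neq (K : fieldType) (n : nat) (lam : 'I_n -> K) (r s : 'I_n) :
  s != r -> 'X - (lam s)%:P %| other_factors lam r.
Proof. by move=> sr; rewrite /other_factors (bigD1 s) //= dvdp_mulr. Qed.

Lemma other_factors_monic (K : fieldType) (n : nat) (lam : 'I_n -> K) (r : 'I_n) :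
  other_factors lam r \is monic.
Proof. exact: monic_prod_XsubC. Qed.

Lemma size_other_factors (K : fieldType) (n : nat) (lam : 'I_n -> K) (r : 'I_n) :
  size (other_factors lam r) = n.
Proof.
rewrite -[LHS]prednK ?size_poly_gt0 ?monic_neq0 ?other_factors_monic //.
rewrite -[in RHS](card_ord n) (cardD1 r) inE add1n; congr _.+1.
rewrite /other_factors size_prod => [|k _]; last by rewrite polyXsubC_eq0.
under eq_bigr do rewrite size_XsubC.
rewrite sum_nat_const muln2 -addnn -addSn addnK /=.
by apply: eq_card => k; rewrite !inE andbT.
Qed.

(** The product is [P = p^2 / ((z - lam r) (z - lam s))]; for [r = s] it is the square left in the
    denominator at the pole [lam r]. *)
Lemma size_other_factorsM (K : fieldType) (n : nat) (lam : 'I_n -> K) (r s : 'I_n) :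
  size (other_factors lam r * other_factors lam s) = (2 * n).-1.
Proof.
rewrite size_monicM ?monic_neq0 ?other_factors_monic // !size_other_factors.
by rewrite mul2n addnn.
Qed.

Lemma dvdp_prod_coprime (K : fieldType) (I : eqType) (s : seq I) (F : I -> {poly K})
    (psi : {poly K}) :
  uniq s -> {in s &, forall i j, i != j -> coprimep (F i) (F j)} ->
  {in s, forall i, F i %| psi} -> \prod_(i <- s) F i %| psi.
Proof.
elim: s => [|i s IH] /=; first by rewrite big_nil dvd1p.
move=> /andP[is_ us] cop dv; rewrite big_cons Gauss_dvdp.
  rewrite dv ?mem_head //= IH // => [j k js ks|j js].
    by apply: cop; rewrite inE ?js ?ks orbT.
  by rewrite dv // inE js orbT.
rewrite big_seq; elim/big_ind: _ => [|x y cx cy|j js].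
- exact: coprimep1.
- by rewrite coprimepMr cx.
- by apply: cop; rewrite ?mem_head ?inE ?js ?orbT //; apply: contraNneq is_ => ->.
Qed.

(** Adding the principal parts of [- phi / p^2] to [phi / p^2] removes all poles, so the numerator
    [psi] is divisible by [p^2]. Its degree is smaller, hence [psi = 0], and its coefficient just
    below the degree of [p^2] is the sum of the residues. *)
Lemma sum_double_pole_residue (K : fieldType) (n : nat) (lam : 'I_n -> K) (phi : {poly K}) :
  injective lam -> (size phi <= (2 * n).-1)%N ->
  \sum_(r < n) double_pole_residue (other_factors lam r) (lam r) phi = 0.
Proof.
move=> hinj szphi; case: n => [|n] in lam hinj szphi *; first by rewrite big_ord0.
pose q r := other_factors lam r.
pose psi := phi + \sum_(r < n.+1) double_pole_part (q r) (lam r) phi * q r ^+ 2.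
have dvd_psi : \prod_(r < n.+1) ('X - (lam r)%:P) ^+ 2 %| psi.
  apply: dvdp_prod_coprime; first exact: index_enum_uniq.
    move=> i j _ _ ij; rewrite coprimep_expl // coprimep_expr //.
    by rewrite coprimep_XsubC2 // subr_eq0 (inj_eq hinj) eq_sym.
  move=> r _; rewrite /psi (bigD1 r) //= addrA dvdp_add //.
    by apply: double_pole_partP; exact: other_factors_root.
  elim/big_ind: _ => [|x y|s sr]; [exact: dvdp0|exact: dvdp_add|].
  by apply: dvdp_mull; rewrite dvdp_exp2r // other_factors_root_neq // eq_sym.
(* Here [n] is one less than the number of nodes. As [q r ^+ 2] is monic of degree [2 * n], only the
   linear term of the principal part reaches degree [(2 * n).+1]. *)
have part_coef r : (double_pole_part (q r) (lam r) phi * q r ^+ 2)`_(2 * n).+1 =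
    double_pole_residue (q r) (lam r) phi.
  have q2m : q r ^+ 2 \is monic by rewrite monic_exp // other_factors_monic.
  have szq2 : size (q r ^+ 2) = (2 * n).+1 by rewrite expr2 size_other_factorsM mulnS.
  rewrite /double_pole_part mulrBl -mulrA mulrBl mulrBr !(coefB, coefCM, coefXM) /=.
  rewrite [(q r ^+ 2)`_(2 * n).+1]nth_default ?szq2 // !mulr0 !subr0.
  by move/monicP: q2m; rewrite lead_coefE szq2 /= => ->; rewrite mulr1.
have szpsi : (size psi <= (2 * n).+2)%N.
  apply: (leq_trans (size_polyD _ _)); rewrite geq_max; apply/andP; split.
    by apply: (leq_trans szphi); rewrite mulnS.
  apply: (leq_trans (size_sum _ _ _)); apply/bigmax_leqP => r _.
  have szpart : (size (double_pole_part (q r) (lam r) phi) <= 2)%N.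
    rewrite (leq_trans (size_polyD _ _)) // geq_max size_polyN; apply/andP; split.
      by rewrite mul_polyC (leq_trans (size_scale_leq _ _)) // size_XsubC.
    by rewrite (leq_trans (size_polyC_leq1 _)).
  apply: (leq_trans (size_polyMleq _ _)); rewrite expr2 size_other_factorsM; lia.
have psi0 : psi = 0.
  apply/eqP/negPn/negP => /dvdp_leq/(_ dvd_psi); apply/negP; rewrite -ltnNge.
  apply: (leq_ltn_trans szpsi).
  rewrite prodrXl expr2 size_monicM ?monic_neq0 ?monic_prod_XsubC //.
  rewrite size_prod_XsubC [index_enum _]unlock -enumT size_enum_ord; lia.
have : psi`_(2 * n).+1 = 0 by rewrite psi0 coef0.
rewrite coefD coef_sum nth_default ?add0r; last first.
  by move: szphi; rewrite mulnS.
by under eq_bigr do rewrite part_coef.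
Qed.

(** * Reversal of polynomials and Taylor coefficients *)

Lemma size_prod_1DZX (K : comNzRingType) (s : seq K) :
  (size (\prod_(x <- s) (1 + x *: 'X))%R <= (size s).+1)%N.
Proof.
elim: s => [|x s IH] /=; first by rewrite big_nil size_poly1.
rewrite big_cons (leq_trans (size_polyMleq _ _)) //.
have : (size (1 + x *: 'X)%R <= 2)%N.
  rewrite (leq_trans (size_polyD _ _)) // geq_max size_poly1 /=.
  by rewrite (leq_trans (size_scale_leq _ _)) // size_polyX.
by move=> h; rewrite -subn1 leq_subLR add1n; apply: (leq_trans (leq_add h IH)).
Qed.

(** Since [\prod (1 + x y) = y^N \prod (1 / y + x)] with [N = size s], one product has the
    coefficients of the other in reverse order. *)
Lemma coef_prod_rev (K : comNzRingType) (s : seq K) (i k : nat) : (i + k)%N = size s ->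
  (\prod_(x <- s) (1 + x *: 'X))`_i = (\prod_(x <- s) ('X + x%:P))`_k.
Proof.
have szl := @size_prod_1DZX K.
have szr (r : seq K) : (size (\prod_(x <- r) ('X + x%:P))%R <= (size r).+1)%N.
  have -> : \prod_(x <- r) ('X + x%:P) = \prod_(x <- r) ('X - (- x)%:P) :> {poly K}.
    by apply: eq_bigr => x _; rewrite polyCN opprK.
  by rewrite size_prod_XsubC.
elim: s i k => [|x s IH] i k /=.
  by move/eqP; rewrite addn_eq0 => /andP[/eqP-> /eqP->]; rewrite !big_nil.
rewrite !big_cons mulrDl mul1r mulrDl -scalerAl !coefD coefZ coefCM !coefXM.
case: i => [|i]; case: k => [|k] //=.
- rewrite mulr0 addr0 add0n => -[E].
  by rewrite (IH 0%N k) // [X in _ + x * X]nth_default ?mulr0 ?addr0 // E.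
- rewrite addn0 add0r => -[E].
  by rewrite [X in X + _]nth_default ?add0r ?(IH i 0%N) ?addn0 // E.
- rewrite addSn => -[E].
  by rewrite (IH i.+1 k) ?(IH i k.+1) ?addSn ?addnS // -E addnS.
Qed.

(** Taylor's formula at [t]; [nderivn] already contains the factor [1 / k!]. *)
Lemma coef_comp_poly_shift (K : comNzRingType) (p : {poly K}) (t : K) (k : nat) :
  (p \Po ('X + t%:P))`_k = p^`N(k).[t].
Proof.
have -> : p \Po ('X + t%:P) = \poly_(i < size p) p^`N(i).[t].
  rewrite /comp_poly addrC (@nderiv_taylor_wide _ (size p)); last 2 first.
  - exact: commr_polyX.
  - by rewrite size_map_polyC.
  by rewrite poly_def; apply: eq_bigr => i _; rewrite nderivn_map horner_map mul_polyC.
by rewrite coef_poly; case: ltnP => // szp; rewrite nderivn_poly0 // horner0.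
Qed.

(** * Differentiation of Leibniz terms and residue kernels in [t] *)

Lemma is_derive_fsum (R : realType) (n : nat) (h : 'I_n -> R -> R) (dh : 'I_n -> R) (x : R) :
  (forall i, is_derive x 1 (h i) (dh i)) ->
  is_derive x 1 (fun t => \sum_(i < n) h i t) (\sum_(i < n) dh i).
Proof.
move=> hd; have -> : (fun t => \sum_(i < n) h i t) = \sum_(i < n) h i.
  by apply/funext => t; rewrite fct_sumE.
exact: is_derive_sum.
Qed.

(** The [s]-th derivative of [f p] divided by [s!], if [h m = f^(m) / m!]. *)
Definition leibniz_term (R : realType) (h : nat -> R -> R) (p : {poly R}) (s : nat) (t : R) : R :=
  \sum_(m < s.+1) h m t * p^`N(s - m).[t].

Lemma is_derive_nderivn (R : realType) (p : {poly R}) (k : nat) (t : R) :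
  is_derive t 1 (horner p^`N(k)) (k.+1%:R * p^`N(k.+1).[t]).
Proof.
have -> : k.+1%:R * p^`N(k.+1).[t] = (p^`N(k))^`().[t].
  rewrite mulr_natl -hornerMn; congr (_.[t]); apply/polyP => i.
  rewrite coefMn !coef_nderivn coef_deriv coef_nderivn -!mulrnA addnS addSn; congr (_ *+ _).
  by rewrite mulnC mul_bin_left -addnS addKn mulnC.
exact: is_derive_poly.
Qed.

Lemma is_derive_leibniz_term (R : realType) (h : nat -> R -> R) (p : {poly R}) (s : nat) (t : R) :
  (forall m, (m <= s)%N -> is_derive t 1 (h m) (m.+1%:R * h m.+1 t)) ->
  is_derive t 1 (leibniz_term h p s) (s.+1%:R * leibniz_term h p s.+1 t).
Proof.
move=> hd.
have -> : s.+1%:R * leibniz_term h p s.+1 t = \sum_(m < s.+1)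
    (h m t *: ((s - m).+1%:R * p^`N((s - m).+1).[t]) + p^`N(s - m).[t] *: (m.+1%:R * h m.+1 t)).
  rewrite big_split /= mulr_sumr.
  (* Splitting [s.+1] as [(s.+1 - i) + i] shares the factor between the two halves of the product
     rule; the term [i = s.+1] of the first half and the term [i = 0] of the second vanish. *)
  have -> : \sum_(i < s.+2) s.+1%:R * (h i t * p^`N(s.+1 - i).[t]) =
      \sum_(i < s.+2) (h i t * ((s.+1 - i)%:R * p^`N(s.+1 - i).[t]) +
        p^`N(s.+1 - i).[t] * (i%:R * h i t)).
    apply: eq_bigr => i _; have -> : s.+1%:R = (s.+1 - i)%:R + i%:R :> R.
      by rewrite -natrD subnK // -ltnS.
    ring.
  rewrite big_split /= big_ord_recr /= subnn mul0r mulr0 addr0; congr (_ + _).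
    by apply: eq_bigr => i _; rewrite subSn // -ltnS.
  rewrite big_ord_recl /= mul0r mulr0 add0r; apply: eq_bigr => i _.
  by rewrite /= /bump add1n subSS.
apply: is_derive_fsum => m.
apply: is_deriveM; first by apply: hd; rewrite -ltnS.
exact: is_derive_nderivn.
Qed.

(** For [s = 2n - 2] these are the [I_i(t)]; the lower powers serve to integrate by parts. *)
Definition residue_kernel (R : realType) (q : {poly R}) (c : R) (s : nat) (t : R) : R :=
  double_pole_residue q c (('X - t%:P) ^+ s).

Lemma residue_kernelE (R : realType) (q : {poly R}) (c : R) (s : nat) (t : R) :
  residue_kernel q c s t = 2 * q^`().[c] / q.[c] ^+ 3 * (c - t) ^+ s
    - q.[c] ^- 2 * (s%:R * (c - t) ^+ s.-1).
Proof.
rewrite /residue_kernel /double_pole_residue deriv_exp derivXsubC mul1r.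
by rewrite hornerMn !horner_exp hornerXsubC -[_ *+ s]mulr_natl.
Qed.

(** The residue is linear in the numerator, and [(z - t)^s] has [t]-derivative
    [- s (z - t)^(s - 1)]. For [s = 0], where [s.-1] is 0, the factor [s] gives the value 0. *)
Lemma is_derive_residue_kernel (R : realType) (q : {poly R}) (c : R) (s : nat) (t : R) :
  is_derive t 1 (residue_kernel q c s) (- s%:R * residue_kernel q c s.-1 t).
Proof.
pose A := 2 * q^`().[c] / q.[c] ^+ 3; pose B := q.[c] ^- 2.
pose w := A *: (c%:P - 'X) ^+ s - (B * s%:R) *: (c%:P - 'X) ^+ s.-1.
have -> : residue_kernel q c s = horner w.
  apply/funext => x; rewrite residue_kernelE /w.
  by rewrite !(hornerD, hornerN, hornerZ, horner_exp, hornerC, hornerX) mulrA.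
have -> : - s%:R * residue_kernel q c s.-1 t = w^`().[t].
  rewrite residue_kernelE /w derivB !derivZ !deriv_exp derivB derivC derivX sub0r.
  rewrite !(hornerD, hornerN, hornerZ, hornerM, hornerMn, horner_exp, hornerC, hornerX).
  rewrite -/A -/B.
  by case: s {w} => [|s] /=; ring.
exact: is_derive_poly.
Qed.

(** With [T_s = s u_s w_(s-1)], the product rule turns the derivative of the [s]-th term into
    [T_(s+1) - T_s]; the sum telescopes to [T_(D+1)], as [T_0 = 0]. *)
Lemma is_derive_kernel_sum (R : realType) (u w : nat -> R -> R) (D : nat) (t : R) :
  (forall s, (s <= D)%N -> is_derive t 1 (u s) (s.+1%:R * u s.+1 t)) ->
  (forall s, is_derive t 1 (w s) (- s%:R * w s.-1 t)) ->
  is_derive t 1 (fun x => \sum_(s < D.+1) u s x * w s x) (D.+1%:R * (u D.+1 t * w D t)).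
Proof.
move=> hu hw.
have -> : D.+1%:R * (u D.+1 t * w D t) = \sum_(s < D.+1)
    (u s t *: (- s%:R * w s.-1 t) + w s t *: (s.+1%:R * u s.+1 t)).
  elim: D {hu} => [|D IH]; rewrite big_ord_recr /= ?big_ord0 -?IH /GRing.scale /=; ring.
apply: is_derive_fsum => s; apply: is_deriveM.
by apply: hu; rewrite -ltnS.
Qed.

(** * Integration against the weight *)

Lemma is_derive_continuous (R : realType) (f : R -> R) (t df : R) :
  is_derive t 1 f df -> {for t, continuous f}.
Proof.
by move=> [df_ _]; apply: differentiable_continuous; apply/derivable1_diffP.
Qed.

(** The interval is open on the left to match the strict inequality in [weight]. The case [c = T]
    occurs at the largest node, where the interval is empty. *)
Lemma integral_of_derivative (R : realType) (F g : R -> R) (c T : R) : c <= T ->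
  (forall t, c <= t <= T -> is_derive t 1 F (g t)) ->
  (forall t, c <= t <= T -> {for t, continuous g}) ->
  (@lebesgue_measure R).-integrable `]c, T] (EFin \o g) /\
  (\int[@lebesgue_measure R]_(t in `]c, T]) (g t)%:E = (F T - F c)%:E)%E.
Proof.
rewrite le_eqVlt => /predU1P[-> _ _|cT dF cg].
  by rewrite set_itv_ge ?bnd_simp ?ltxx // integral_set0 subrr; split => //; exact: integrable_set0.
have cg' : {within `[c, T], continuous g}.
  apply: continuous_in_subspaceT => t; rewrite inE /= in_itv /= => ct; exact: cg.
have intg : (@lebesgue_measure R).-integrable `[c, T] (EFin \o g).
  by apply: continuous_compact_integrable => //; exact: segment_compact.
have intg' : (@lebesgue_measure R).-integrable `]c, T] (EFin \o g).
  apply: integrableS intg => //; exact: subset_itv_oc_cc.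
split=> //.
rewrite integral_itv_obnd_cbnd; last first.
  exact: (measurable_int (@lebesgue_measure R)).
rewrite (continuous_FTC2 cT cg' (F := F)) //.
  have cF t : c <= t <= T -> {for t, continuous F}.
    by move=> /dF; exact: is_derive_continuous.
  split.
  - move=> t; rewrite in_itv /= => /andP[ct tT].
    by have [] := dF t; first by rewrite !ltW.
  - by apply: cvg_at_right_filter; apply: cF; rewrite lexx ltW.
  - by apply: cvg_at_left_filter; apply: cF; rewrite lexx ltW.
move=> t; rewrite in_itv /= => /andP[ct tT].
by rewrite derive1E; apply: derive_val; apply: dF; rewrite !ltW.
Qed.

Lemma Ires_kernel (R : realType) (n : nat) (lam : 'I_n -> R) (i : 'I_n) (t : R) :
  injective lam ->
  Ires lam i t = residue_kernel (other_factors lam i) (lam i) (2 * n - 2) t.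
Proof.
move=> hinj; apply: residueE; rewrite /pLambda (bigD1 i) //=.
by apply: is_residue_double_pole; exact: other_factors_root.
Qed.

(** Integration by parts for an abstract sequence [u], later [(f P)^(s) / s!]. The hypotheses
    concern only points between two nodes, which lie inside the interval of smoothness of [f]. *)
Lemma weighted_integral (R : realType) (n : nat) (lam : 'I_n -> R) (u : nat -> R -> R) :
  (2 <= n)%N -> injective lam ->
  (forall i j t, lam i <= t <= lam j -> forall s, (s <= 2 * n - 2)%N ->
    is_derive t 1 (u s) (s.+1%:R * u s.+1 t)) ->
  (forall i j t, lam i <= t <= lam j -> {for t, continuous (u (2 * n - 1)%N)}) ->
  (@lebesgue_measure R).-integrable setT (fun t => (weight lam t * u (2 * n - 1)%N t)%:E) /\
  (2 * n - 1)%:R * \int[@lebesgue_measure R]_(t in setT) (weight lam t * u (2 * n - 1)%N t) =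
  - \sum_(r < n) \sum_(s < 2)
      u s (lam r) * residue_kernel (other_factors lam r) (lam r) s (lam r).
Proof.
move=> n2 hinj du cu; set mu := @lebesgue_measure R.
have [i0 _ maxT] := @arg_maxP _ R 'I_n (Ordinal (ltnW n2)) xpredT lam isT.
set T := lam i0; pose D := (2 * n - 2)%N.
have EN : (2 * n - 1)%N = D.+1 by rewrite /D; lia.
rewrite EN in cu *; rewrite -/D in du.
pose w r := residue_kernel (other_factors lam r) (lam r).
pose F r t := \sum_(s < D.+1) u s t * w r s t.
have dF r t : lam r <= t <= T ->
    is_derive t 1 (D.+1%:R^-1 \*: F r) (u D.+1 t * w r D t).
  move=> rtT; have dFr : is_derive t 1 (F r) (D.+1%:R * (u D.+1 t * w r D t)).
    by apply: is_derive_kernel_sum (du _ _ _ rtT) _ => s; exact: is_derive_residue_kernel.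
  have := is_deriveZ D.+1%:R^-1 dFr.
  by rewrite /GRing.scale /= mulKf // pnatr_eq0.
have FTC r := integral_of_derivative (maxT r isT) (dF r).
pose piece r := (fun t => u D.+1 t * w r D t) \_ `]lam r, T].
have weightE t : weight lam t * u D.+1 t = \sum_(r < n) piece r t.
  have [tT|Tt] := leP t T.
    rewrite /weight mulr_suml big_mkcond; apply: eq_bigr => r _.
    rewrite /piece patchE mem_setE in_itv /= tT andbT.
    by case: ifP => // _; rewrite Ires_kernel // mulrC.
  rewrite [RHS]big1 => [|r _]; last first.
    by rewrite /piece patchE mem_setE in_itv /= [t <= T]leNgt Tt andbF.
  (* To the right of all nodes every residue enters the weight, and together they cancel because
     [('X - t)^D] has degree [2n - 2]. *)
  suff -> : weight lam t = 0 by rewrite mul0r.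
  rewrite /weight -[RHS](@sum_double_pole_residue _ _ lam (('X - t%:P) ^+ D) hinj).
    rewrite (eq_bigl xpredT) => [|r]; first by apply: eq_bigr => r _; rewrite Ires_kernel.
    by rewrite (le_lt_trans _ Tt) //; exact: maxT.
  by rewrite size_exp_XsubC /D; lia.
have FTCr r : mu.-integrable `]lam r, T] (EFin \o (fun t => u D.+1 t * w r D t)) /\
    (\int[mu]_(t in `]lam r, T]) (u D.+1 t * w r D t)%:E =
      (D.+1%:R^-1 * (F r T - F r (lam r)))%:E)%E.
  rewrite mulrBr; apply: FTC => t rtT; apply: continuousM; first exact: cu rtT.
  exact: is_derive_continuous (is_derive_residue_kernel _ _ _ _).
have EFin_piece r : EFin \o piece r = (EFin \o (fun t => u D.+1 t * w r D t)) \_ `]lam r, T].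
  by rewrite /piece restrict_EFin.
have int_piece r : mu.-integrable setT (EFin \o piece r).
  rewrite EFin_piece; apply: (integrable_mkcond _ _).1 (FTCr r).1; exact: measurable_itv.
have E : (fun t => (weight lam t * u D.+1 t)%:E) = (fun t => \sum_(r < n) (EFin \o piece r) t)%E.
  by apply/funext => t; rewrite weightE sumEFin.
split; first by rewrite E; apply: integrable_sum => // r _; exact: int_piece.
have -> : \int[mu]_t (weight lam t * u D.+1 t) =
    \sum_(r < n) D.+1%:R^-1 * (F r T - F r (lam r)).
  rewrite /Rintegral E integral_sum //.
  under eq_bigr => r _ do rewrite EFin_piece -integral_mkcond (FTCr r).2.
  by rewrite sumEFin.
rewrite -mulr_sumr mulVKf ?pnatr_eq0 // sumrB.
(* At the common upper end the residues cancel for each power [s <= D] separately. *)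
have -> : \sum_(r < n) F r T = 0.
  rewrite /F exchange_big /= big1 // => s _; rewrite -mulr_sumr.
  rewrite [X in _ * X](@sum_double_pole_residue _ _ lam (('X - T%:P) ^+ s) hinj) ?mulr0 //.
  by rewrite size_exp_XsubC; move: (ltn_ord s); rewrite /D; lia.
rewrite sub0r; congr (- _); apply: eq_bigr => r _; rewrite /F.
(* Orders 0 and 1 are split off; for higher orders both terms of the kernel contain a positive power
   of [c - t], which is 0 at the node itself. *)
have -> : D.+1 = (2 + (D.+1 - 2))%N by rewrite /D; lia.
rewrite big_split_ord /= [X in _ + X]big1 ?addr0 // => s _.
by rewrite /w residue_kernelE subrr !expr0n /= !mulr0 subr0 mulr0.
Qed.

(** * The entries of [C^T M C] *)

(** A Hankel form depends on two coefficient vectors only through the product of the polynomials: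
    the entries with index sum [m] collect into its coefficient of degree [m]. *)
Lemma sum_coefM (K : comNzRingType) (p q : {poly K}) (n : nat) (g : nat -> K) :
  (size p <= n)%N -> (size q <= n)%N ->
  \sum_(m < 2 * n - 1) g m * (p * q)`_m = \sum_(k < n) \sum_(l < n) p`_k * q`_l * g (k + l)%N.
Proof.
move=> szp szq.
have polyE (r : {poly K}) : (size r <= n)%N -> r = \sum_(k < n) r`_k *: 'X^k.
  move=> szr; rewrite -poly_def; apply/polyP => i; rewrite coef_poly.
  by case: ltnP => // ni; rewrite nth_default // (leq_trans szr).
have pqE : p * q = \sum_(k < n) \sum_(l < n) (p`_k * q`_l) *: 'X^(k + l).
  rewrite [in LHS](polyE p szp) [in LHS](polyE q szq) mulr_suml; apply: eq_bigr => k _.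
  rewrite mulr_sumr; apply: eq_bigr => l _.
  by rewrite -scalerAl -scalerAr scalerA exprD.
under eq_bigr => m _.
  rewrite pqE coef_sum mulr_sumr; under eq_bigr do rewrite coef_sum mulr_sumr.
  over.
rewrite exchange_big; apply: eq_bigr => k _; rewrite exchange_big; apply: eq_bigr => l _ /=.
have kl : (k + l < 2 * n - 1)%N by move: (ltn_ord k) (ltn_ord l); lia.
rewrite (bigD1 (Ordinal kl)) //= coefZ coefXn eqxx mulr1 mulrC big1 ?addr0 // => m mkl.
by rewrite coefZ coefXn -[_ == _]/(m == Ordinal kl) (negbTE mkl) !mulr0.
Qed.

Lemma size_map_neq_ord (n : nat) (K : eqType) (g : 'I_n -> K) (i : 'I_n) :
  size [seq g k | k <- index_enum _ & k != i] = n.-1.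
Proof.
rewrite size_map [index_enum _]unlock.
by rewrite -[RHS](congr1 predn (card_ord n)) -(cardC1 i) cardE /enum_mem.
Qed.

Lemma Cpoly_shifts (R : realType) (n : nat) (t : R) (lam : 'I_n -> R) (i : 'I_n) :
  Cpoly t lam i = \prod_(x <- [seq t - lam k | k <- index_enum _ & k != i]) (1 + x *: 'X).
Proof. by rewrite big_map big_filter. Qed.

Lemma size_Cpoly (R : realType) (n : nat) (t : R) (lam : 'I_n -> R) (i : 'I_n) :
  (size (Cpoly t lam i) <= n)%N.
Proof.
rewrite Cpoly_shifts (leq_trans (size_prod_1DZX _)) //.
by rewrite (size_map_neq_ord (fun k => t - lam k)) prednK // (leq_ltn_trans _ (ltn_ord i)).
Qed.

(** The factors of both polynomials form one list of [2n - 2] shifts. Reversal sends degree [m] to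
    degree [2n - 2 - m] in the product of the ['X + (t - lam k)], which is the product of the
    cofactors translated by [t]. *)
Lemma coef_Cpoly_mul (R : realType) (n : nat) (t : R) (lam : 'I_n -> R) (i j : 'I_n) (m : nat) :
  (m <= 2 * n - 2)%N ->
  (Cpoly t lam i * Cpoly t lam j)`_m =
    (other_factors lam i * other_factors lam j)^`N(2 * n - 2 - m).[t].
Proof.
move=> mn; rewrite -coef_comp_poly_shift !Cpoly_shifts -big_cat.
rewrite (@coef_prod_rev _ _ _ (2 * n - 2 - m)); last first.
  rewrite size_cat (size_map_neq_ord (fun k => t - lam k)).
  rewrite (size_map_neq_ord (fun k => t - lam k)); move: mn (ltn_ord i); lia.
rewrite big_cat /= comp_polyM.
have shiftE k : other_factors lam k \Po ('X + t%:P) =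
    \prod_(x <- [seq t - lam l | l <- index_enum _ & l != k]) ('X + x%:P).
  rewrite big_map big_filter rmorph_prod; apply: eq_bigr => l _.
  by rewrite rmorphB /= comp_polyX comp_polyC polyCB addrA.
by rewrite !shiftE.
Qed.

(** * Evaluation at the nodes *)

Lemma deriv_other_factors (R : realType) (n : nat) (lam : 'I_n -> R) (i j : 'I_n) :
  injective lam -> i != j ->
  (other_factors lam j)^`().[lam i] = (other_factors lam i).[lam i] / (lam i - lam j).
Proof.
(* [g] omits both nodes; each cofactor is [g] times one linear factor, and the one vanishing at
   [lam i] has derivative [g] there. *)
move=> hinj ij; pose g := \prod_(k < n | (k != j) && (k != i)) ('X - (lam k)%:P).
have -> : other_factors lam j = ('X - (lam i)%:P) * g.
  by rewrite /other_factors (bigD1 i).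
have -> : other_factors lam i = ('X - (lam j)%:P) * g.
  rewrite /other_factors (bigD1 j) 1?eq_sym //=; congr (_ * _).
  by apply: eq_bigl => k; rewrite andbC.
rewrite derivM derivXsubC mul1r hornerD !hornerM !hornerXsubC subrr mul0r addr0.
by rewrite mulrAC mulfV ?mul1r // subr_eq0 inj_eq.
Qed.

Lemma other_factors_root0 (K : fieldType) (n : nat) (lam : 'I_n -> K) (r s : 'I_n) :
  r != s -> (other_factors lam s).[lam r] = 0.
Proof.
move=> rs; apply/eqP; rewrite -[_ == _]/(root _ _) -dvdp_XsubCl.
exact: other_factors_root_neq.
Qed.

(** For [i != j] the product [P] has double zeros at all other nodes and simple zeros at [lam i] and
    [lam j]. There only [f P'] survives, giving [f (lam i) / (lam i - lam j)] and
    [f (lam j) / (lam j - lam i)]. For [i = j] the terms in [f (lam i)] cancel and the derivative of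
    [f] remains. *)
Lemma sum_kernel_loewner (R : realType) (n : nat) (lam : 'I_n -> R) (i j : 'I_n)
    (h : nat -> R -> R) (f : R -> R) :
  injective lam -> h 0%N = f -> h 1%N = (f^`())%classic ->
  - (\sum_(r < n) \sum_(s < 2)
      leibniz_term h (other_factors lam i * other_factors lam j) s (lam r)
        * residue_kernel (other_factors lam r) (lam r) s (lam r)) =
  loewner lam f i j.
Proof.
move=> hinj h0 h1; set q := other_factors lam; rewrite -sumrN.
have qr r : (q r).[lam r] != 0 by exact: other_factors_root.
have termE r : - (\sum_(s < 2) leibniz_term h (q i * q j) s (lam r)
    * residue_kernel (q r) (lam r) s (lam r)) =
    ((f^`())%classic (lam r) * ((q i).[lam r] * (q j).[lam r]) +
     f (lam r) * ((q i)^`().[lam r] * (q j).[lam r] + (q i).[lam r] * (q j)^`().[lam r]))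
      / (q r).[lam r] ^+ 2
    - 2 * (q r)^`().[lam r] * f (lam r) * ((q i).[lam r] * (q j).[lam r]) / (q r).[lam r] ^+ 3.
  rewrite !big_ord_recl big_ord0 /leibniz_term !big_ord_recl !big_ord0 /= /bump /=.
  rewrite !residue_kernelE subrr /= h0 h1 nderivn0 nderivn1 !addr0 derivM.
  by rewrite !(hornerD, hornerM); field.
under eq_bigr do rewrite termE.
rewrite /loewner mxE /divided_difference; case: ifP => [/eqP/hinj ij|/negbT]; last first.
  rewrite inj_eq // => ij.
  rewrite (bigD1 i) //= (bigD1 j) 1?eq_sym //= big1 => [|r /andP[ri rj]]; last first.
    rewrite /q !(other_factors_root0 _ ri) !(other_factors_root0 _ rj).
    by rewrite !(mulr0, mul0r, addr0, subr0).
  have ji : j != i by rewrite eq_sym.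
  rewrite /q (other_factors_root0 _ ij) (other_factors_root0 _ ji).
  rewrite (deriv_other_factors hinj ij) (deriv_other_factors hinj ji) -/q.
  have lij : lam i - lam j != 0 by rewrite subr_eq0 inj_eq.
  have lji : lam j - lam i != 0 by rewrite subr_eq0 inj_eq.
  by field; rewrite lij lji !qr.
rewrite -ij (bigD1 i) //= big1 => [|r ri]; last first.
  by rewrite /q !(other_factors_root0 _ ri) !(mulr0, mul0r, addr0, subr0).
by field; rewrite qr.
Qed.

(** * Assembly of the integral formula *)

Lemma continuous_leibniz_term (R : realType) (h : nat -> R -> R) (p : {poly R}) (s : nat) (t : R) :
  (forall m, (m <= s)%N -> {for t, continuous (h m)}) ->
  {for t, continuous (leibniz_term h p s)}.
Proof.
move=> hc; rewrite /leibniz_term.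
have hc' (m : 'I_s.+1) : {for t, continuous (fun x => h m x * p^`N(s - m).[x])}.
  apply: continuousM; first by apply: hc; rewrite -ltnS.
  exact: continuous_horner.
by apply: cvg_big => [|m _]; [exact: add_continuous|exact: hc'].
Qed.

Lemma leibniz_term_bilinear (R : realType) (n : nat) (lam : 'I_n -> R) (i j : 'I_n)
    (h : nat -> R -> R) (t : R) : (0 < n)%N ->
  leibniz_term h (other_factors lam i * other_factors lam j) (2 * n - 1) t =
  \sum_(k < n) \sum_(l < n) (Cpoly t lam i)`_k * (Cpoly t lam j)`_l * h (k + l).+1 t.
Proof.
move=> n0; rewrite -(sum_coefM (fun m => h m.+1 t)) ?size_Cpoly //.
(* The term in [h 0], that is in [f] itself, drops out because the product has degree [2n - 2]; the
   resulting shift by one gives the index [(k + l).+1] of the Hankel matrix. *)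
rewrite /leibniz_term big_ord_recl /= subn0 nderivn_poly0 ?horner0 ?mulr0 ?add0r.
  apply: eq_bigr => m _; have mn := ltn_ord m.
  by rewrite coef_Cpoly_mul ?/bump /=; [congr (_ * _^`N(_).[_]); lia|lia].
by rewrite size_other_factorsM; lia.
Qed.

Theorem theorem17 (R : realType) (n : nat) (hn : (2 <= n)%N)
    (a b : \bar R) (lam : 'I_n -> R)
    (hlam : forall i, open_interval a b (lam i)) (hinj : injective lam)
    (f : R -> R) (hf : class_C (2 * n - 1) (open_interval a b) f) :
  integrable_mx (integrand lam f) /\
  loewner lam f = (2 * n - 1)%:R *: integral_mx (integrand lam f).
Proof.
have [df cf] := hf.
have lam_ab i j t : lam i <= t <= lam j -> open_interval a b t.
  move=> /andP[it tj]; have /andP[ai _] := hlam i; have /andP[_ jb] := hlam j.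
  rewrite /open_interval /= (lt_le_trans ai) ?lee_fin //=.
  by rewrite (le_lt_trans _ jb) // lee_fin.
(* The factor [1 / m!] yields the recursion [h_m' = (m + 1) h_(m+1)] assumed for the Leibniz
   terms. *)
pose h m t : R := m`!%:R^-1 * (f^`(m))%classic t.
have dh m t : (m < 2 * n - 1)%N -> open_interval a b t ->
    is_derive t 1 (h m) (m.+1%:R * h m.+1 t).
  move=> mn abt; have := is_deriveZ m`!%:R^-1 (derivableP (df m t mn abt)).
  rewrite /h -derive1E -derive1nS factS natrM invfM /GRing.scale /= !mulrA mulfV ?mul1r //.
have ch m t : (m <= 2 * n - 1)%N -> open_interval a b t -> {for t, continuous (h m)}.
  rewrite leq_eqVlt => /predU1P[->|mn] abt; last exact: is_derive_continuous (dh m t mn abt).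
  by apply: continuousM; [exact: cvg_cst|exact: cf].
(* A purely algebraic identity, valid for every [t], also where the derivatives of [f] are
   unspecified. *)
have E i j t : integrand lam f t i j = weight lam t *
    leibniz_term h (other_factors lam i * other_factors lam j) (2 * n - 1) t.
  rewrite leibniz_term_bilinear ?(ltnW hn) // /integrand mxE; congr (_ * _).
  rewrite mxE; under eq_bigr do rewrite mxE mulr_suml.
  rewrite exchange_big; apply: eq_bigr => k _; apply: eq_bigr => l _.
  by rewrite !mxE /h; ring.
have W i j := @weighted_integral R n lam
  (leibniz_term h (other_factors lam i * other_factors lam j)) hn hinj.
have {}W i j : (@lebesgue_measure R).-integrable setT (fun t => (integrand lam f t i j)%:E) /\
    (2 * n - 1)%:R * \int[@lebesgue_measure R]_(t in setT) integrand lam f t i j =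
    loewner lam f i j.
  under eq_fun do rewrite E; under eq_Rintegral do rewrite E.
  have [|i' j' t ijt|intW ->] := W i j.
  - move=> i' j' t ijt s sn; apply: is_derive_leibniz_term => m ms.
    by apply: dh (lam_ab _ _ _ ijt); lia.
  - by apply: continuous_leibniz_term => m ms; apply: ch (lam_ab _ _ _ ijt); lia.
  - split=> //; apply: sum_kernel_loewner => //.
      by apply/funext => t; rewrite /h fact0 invr1 mul1r.
    by apply/funext => t; rewrite /h invr1 mul1r.
split; first by move=> i j; have [] := W i j.
by apply/matrixP => i j; have [_ <-] := W i j; rewrite !mxE.
Qed.
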